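(* Let $t\ge2$, $\zeta=e^{2\pi i/t}$, $N=t+2$, and let $\lambda$ be a partition with at most $N$ parts. Let $\mathrm{SSYT}(\lambda,t+2)$ be the set of semistandard Young tableaux of shape $\lambda$ with entries in $\{1,\dots,t+2\}$, and let $m_k(T)$ be the number of entries equal to $k$ in $T$. With $z=e^\theta$, $$\sum_{T\in\mathrm{SSYT}(\lambda,t+2)}\zeta^{\,\sum_{k=1}^t(k-1)m_k(T)}\,z^{\,m_{t+1}(T)-m_{t+2}(T)}=\varepsilon_\lambda\,\frac{\sinh(d_1\theta/2)\sinh(d_2\theta/2)\sinh(d_3\theta/2)}{\sinh^2(t\theta/2)\sinh\theta},$$ where the right-hand side is understood to be $0$ when some residue class modulo $t$ contains no element of $\beta(\lambda)$ or when $\tilde d_3=0$.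
   Context: For $\lambda=(\lambda_1\ge\dots\ge\lambda_N\ge0)$ let $\beta_j=\lambda_j+N-j$ ($1\le j\le N$; $j$ is the column of $\beta_j$), $\beta(\lambda)=\{\beta_1>\dots>\beta_N\}$, and let $n_i$ be the number of $\beta_j\equiv i\pmod t$. Since $\sum_i n_i=t+2$, if no class is empty then either exactly two classes have size $2$ (others $1$) or exactly one has size $3$ (others $1$). In the first case let $r_A<r_B$ be the two residues and $A=\{a_1>a_2\}$, $B=\{b_1>b_2\}$ the elements of $\beta(\lambda)$ in classes $r_A,r_B$; in the second case, with class $\{p>q>r\}$, let $A=\{a_1>a_2\}=\{p,q\}$, $B=\{b_1>b_2\}=\{q,r\}$. Put $d_1=a_1-a_2$, $d_2=b_1-b_2$, $\tilde d_3=a_1+a_2-b_1-b_2$, $d_3=|\tilde d_3|$. For $\tilde d_3\neq0$, $\varepsilon_\lambda=(-1)^{t+\binom{N+1}{2}}(-1)^{j_{A_1}+j_{B_1}+\operatorname{inv}(b_S)}\operatorname{sgn}(a_1-b_1)\operatorname{sgn}(\tilde d_3)$, where $j_{A_1},j_{B_1}$ are the columns of $a_1,b_1$, $S=\{1,\dots,N\}\setminus\{j_{A_1},j_{B_1}\}$, $b_S$ is the word of residues $\beta_j\bmod t\in\{0,\dots,t-1\}$ for $j\in S$ in increasing order of $j$, and $\operatorname{inv}$ counts inversions. The identity is read as one of rational functions. *)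

(* Defs.v *)
From HB Require Import structures.
From mathcomp Require Import all_boot all_order all_algebra.
From mathcomp Require Import complex.
From mathcomp Require Import reals trigo.

Set Implicit Arguments.
Unset Strict Implicit.
Unset Printing Implicit Defensive.

Import Order.TTheory GRing.Theory Num.Theory.
Local Open Scope ring_scope.

Definition is_partition (N : nat) (lam : N.-tuple nat) : bool := sorted geq lam.

(* [lam`_0 = head 0 lam] bounds all the parts of a partition, so that this is
   the whole Young diagram; rows and columns are numbered from 0. *)
Definition cell (N : nat) (lam : N.-tuple nat) : finType :=
  {c : 'I_N * 'I_(head 0%N lam) | (c.2 < tnth lam c.1)%N}.

Definition crow (N : nat) (lam : N.-tuple nat) (c : cell lam) : 'I_N :=
  (val c).1.

Definition ccol (N : nat) (lam : N.-tuple nat) (c : cell lam) :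
  'I_(head 0%N lam) := (val c).2.

(* [x : 'I_n] stands for the entry [x.+1] of {1, ..., n}. *)
Definition filling (N : nat) (lam : N.-tuple nat) (n : nat) : finType :=
  {ffun cell lam -> 'I_n}.

Definition SSYT (N : nat) (lam : N.-tuple nat) (n : nat) :
    {set filling lam n} :=
  [set T : filling lam n |
    [forall c, forall c',
      ((crow c == crow c') && (ccol c < ccol c')%N ==> (T c <= T c')%N) &&
      ((ccol c == ccol c') && (crow c < crow c')%N ==> (T c < T c')%N)]].

Definition mult (N : nat) (lam : N.-tuple nat) (n : nat)
    (T : filling lam n) (k : nat) : nat :=
  #|[set c | (T c).+1 == k]|.

(* The column of [j : 'I_N] is [j.+1], whence [N - j.+1] below. *)
Definition beta (N : nat) (lam : N.-tuple nat) (j : 'I_N) : nat :=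
  (tnth lam j + (N - j.+1))%N.

(* The columns of the elements of the beta-set congruent to [i], from left to
   right, that is, by decreasing value of [beta]. *)
Definition class_cols (N : nat) (lam : N.-tuple nat) (t i : nat) : seq 'I_N :=
  [seq j <- enum 'I_N | beta lam j == i %[mod t]].

Definition has_empty_class (N : nat) (lam : N.-tuple nat) (t : nat) : bool :=
  [exists i : 'I_t, nilp (class_cols lam t i)].

Record AB_cols (N : nat) := ABCols { jA1 : 'I_N; jA2 : 'I_N;
                                     jB1 : 'I_N; jB2 : 'I_N }.

(* The columns of a1, a2, b1, b2. When N = t + 2, this is [None] only if some
   class is empty. *)
Definition select_AB (N : nat) (lam : N.-tuple nat) (t : nat) :
    option (AB_cols N) :=
  match [seq cl <- [seq class_cols lam t i | i <- iota 0 t] | 1 < size cl]%N with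
  | [:: [:: a1; a2]; [:: b1; b2]] => Some (ABCols a1 a2 b1 b2)
  | [:: [:: p; q; r]] => Some (ABCols p q q r)
  | _ => None
  end.

Section SignAndDistances.
Context {N : nat}.
Implicit Types (lam : N.-tuple nat) (s : AB_cols N).

Definition d1 lam s : int := (beta lam (jA1 s))%:Z - (beta lam (jA2 s))%:Z.

Definition d2 lam s : int := (beta lam (jB1 s))%:Z - (beta lam (jB2 s))%:Z.

Definition d3t lam s : int :=
  (beta lam (jA1 s))%:Z + (beta lam (jA2 s))%:Z
  - (beta lam (jB1 s))%:Z - (beta lam (jB2 s))%:Z.

Definition d3 lam s : int := `|d3t lam s|.

Definition setS s : {set 'I_N} := ~: [set jA1 s; jB1 s].

Definition inv_bS lam (t : nat) s : nat :=
  #|[set p : 'I_N * 'I_N |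
      [&& p.1 \in setS s, p.2 \in setS s, (p.1 < p.2)%N
        & (beta lam p.2 %% t < beta lam p.1 %% t)%N]]|.

Definition eps lam (t : nat) s : int :=
  (-1) ^+ (t + 'C(N.+1, 2)) *
  (-1) ^+ ((jA1 s).+1 + (jB1 s).+1 + inv_bS lam t s) *
  sgz ((beta lam (jA1 s))%:Z - (beta lam (jB1 s))%:Z) *
  sgz (d3t lam s).

End SignAndDistances.

(* exp(2 i pi / t) *)
Definition zeta (R : realType) (t : nat) : R[i]%C :=
  (cos (2 * pi / t%:R) +i* sin (2 * pi / t%:R))%C.

(* Rational functions in the indeterminate exp(theta / 2): the hyperbolic sines
   are taken at half-integer multiples of theta. *)
Definition ratfun (R : realType) : fieldType := {fraction {poly R[i]%C}}.

Definition ratC (R : realType) (c : R[i]%C) : ratfun R :=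
  FracField.tofrac (c%:P).

Definition exp_half_theta (R : realType) : ratfun R := FracField.tofrac 'X.

Definition exp_theta (R : realType) : ratfun R := exp_half_theta R ^+ 2.

(* sinh(d theta / 2) *)
Definition sinh_half (R : realType) (d : int) : ratfun R :=
  (exp_half_theta R ^ d - exp_half_theta R ^ (- d)) / 2%:R.

(* Main.v *)
Require Import Defs.
From HB Require Import structures.
From mathcomp Require Import all_boot all_order all_algebra.
From mathcomp Require Import complex.
From mathcomp Require Import reals trigo.
From mathcomp Require Import perm zify ring.

(** The sum over tableaux is the Schur polynomial of lambda at the point
    x = (1, zeta, ..., zeta^(t-1), z, z^-1), hence the ratio of the alternants
    det (x_i ^ beta_j) of lambda and of the empty partition. The ratio formula
    holds because both sides obey the same branching rule: removing the boxes
    with the largest entry leaves a partition interlacing lambda, and clearing the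
    last row of the alternant by column operations leaves geometric sums whose
    exponents range over the same interlacing partitions.

    A discrete Fourier transform of the first t rows multiplies both alternants
    by the same factor and turns these rows into the indicators of
    beta_j = r mod t. An empty class gives a zero row. Otherwise, subtracting
    column a2 from a1 and b2 from b1 leaves a permutation matrix on S and the
    2 x 2 minor of (z^beta, z^-beta) on the columns of a1 and b1, which factors
    into three hyperbolic sines. *)

Set Implicit Arguments.
Unset Strict Implicit.
Unset Printing Implicit Defensive.

Import Order.TTheory GRing.Theory Num.Theory.
Local Open Scope ring_scope.

(** * The branching rule for alternants *)

Definition alternant (K : comNzRingType) (n : nat) (x : nat -> K)
    (b : 'I_n -> nat) : K :=
  \det (\matrix_(i < n, j < n) x i ^+ b j).

(** The condition bears on one row at a time, so that the interlacing partitions form a product of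
    intervals, a [family] over which a product of sums distributes. *)
Definition interlacing (n : nat) (lam : n.+1.-tuple nat) (i : 'I_n) :
    pred 'I_(head 0%N lam).+1 :=
  [pred k : 'I__ | (nth 0%N lam i.+1 <= k <= nth 0%N lam i)%N].
Arguments interlacing {n} lam i _.

Definition shape_tuple (n M : nat) (mu : {ffun 'I_n -> 'I_M}) : n.-tuple nat :=
  [tuple (mu i : nat) | i < n].

Lemma nth_shape_tuple (n M : nat) (mu : {ffun 'I_n -> 'I_M}) (i : 'I_n) :
  nth 0%N (shape_tuple mu) i = mu i.
Proof. by rewrite -tnth_nth tnth_mktuple. Qed.

Lemma partition_nth (N : nat) (lam : N.-tuple nat) (i j : nat) :
  is_partition lam -> (i <= j)%N -> (nth 0%N lam j <= nth 0%N lam i)%N.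
Proof.
move=> hlam le_ij; have [ltj|] := ltnP j N; last first.
  by move=> leNj; rewrite nth_default ?size_tuple.
have geq_trans : transitive geq by move=> a b c /= ba cb; exact: leq_trans cb ba.
by apply: (sorted_leq_nth geq_trans leqnn 0%N hlam);
  rewrite ?inE ?size_tuple // (leq_ltn_trans le_ij).
Qed.

(** The terms [x ^+ (k + e) * y ^+ (l.+1 - k)] telescope between [k = l'] and [k = l.+1]. *)
Lemma homogeneous_geometric_sum (K : comNzRingType) (x y : K) (e l l' M : nat) :
  (l' <= l < M)%N ->
  x ^+ (l + e.+1) - y ^+ (l.+1 - l') * x ^+ (l' + e) =
  (x - y) * \sum_(k < M | (l' <= k <= l)%N) x ^+ (k + e) * y ^+ (l - k).
Proof.
case/andP=> le_l'l lt_lM.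
transitivity ((x - y) * \sum_(l' <= k < l.+1) x ^+ (k + e) * y ^+ (l - k)).
  rewrite mulr_sumr (telescope_sumr_eq (fun k => x ^+ (k + e) * y ^+ (l.+1 - k))).
  - by rewrite subnn mulr1 mulrC addSnnS.
  - exact: leqW.
  by move=> k /andP[_]; rewrite ltnS => le_kl; rewrite /= addSn subSS subSn // !exprS; ring.
congr (_ * _); rewrite (big_nat_widen _ _ M) // big_geq_mkord.
by apply: eq_bigl => k; rewrite andbC ltnS.
Qed.

(** Subtracting from each column a multiple of the next one clears the last row outside the last
    column. In row [i] the new entry is [x i - x n] times a geometric sum over the possible values
    of [mu j]. *)
Lemma alternant_branching (K : comNzRingType) (n : nat) (x : nat -> K)
    (lam : n.+1.-tuple nat) : is_partition lam ->
  alternant x (beta lam) =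
  (\prod_(i < n) (x i - x n)) *
  \sum_(mu in family (interlacing lam))
     (\prod_(i < n) x n ^+ (nth 0%N lam i - mu i)) * x n ^+ nth 0%N lam n *
     alternant x (beta (shape_tuple mu)).
Proof.
move=> hlam; pose c (j : nat) := ((nth 0%N lam j).+1 - nth 0%N lam j.+1)%N.
(* Right multiplication by [U] performs the column operations: [c j] is the gap between the
   exponents of columns [j] and [j.+1], and the last column, which has no successor, is kept. *)
pose U := \matrix_(i < n.+1, j < n.+1)
  ((i == j)%:R - (i == j.+1 :> nat)%:R * x n ^+ c j) : 'M[K]_n.+1.
pose A : 'M[K]_n.+1 := \matrix_(i < n.+1, j < n.+1) x i ^+ beta lam j.
have detU : \det U = 1.
  rewrite det_trig; first by apply: big1 => i _; rewrite !mxE eqxx ltn_eqF // mul0r subr0.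
  apply/is_trig_mxP => i j lt_ij; rewrite !mxE.
  by rewrite -val_eqE !ltn_eqF ?mul0r ?subr0 // ltnW.
have betaE j : beta lam j = (nth 0%N lam j + (n - j))%N by rewrite /beta (tnth_nth 0%N) subSS.
have AUE i (j : 'I_n) : (A *m U) i (lift ord_max j) =
  (x i - x n) * \sum_(k | interlacing lam j k)
     x i ^+ (k + (n - j.+1)) * x n ^+ (nth 0%N lam j - k).
  rewrite mxE -homogeneous_geometric_sum; last first.
    rewrite partition_nth //= ltnS -nth0; exact: partition_nth.
  under eq_bigr do rewrite !mxE mulrBr.
  rewrite sumrB (bigD1 (lift ord_max j)) //= eqxx mulr1 big1 ?addr0; last first.
    by move=> k /negbTE->; rewrite mulr0.
  rewrite (bigD1 (lift ord0 j)) //= [X in _ - (_ + X)]big1 ?addr0; last first.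
    move=> k; rewrite -val_eqE /= /bump /= leqNgt ltn_ord add0n add1n.
    by move=> /negbTE->; rewrite mul0r mulr0.
  rewrite !betaE /= /bump /= leqNgt ltn_ord add0n add1n eqxx mul1r mulrC /c.
  by rewrite subnSK.
have AUn (j : 'I_n.+1) : (A *m U) ord_max j = (j == ord_max)%:R * x n ^+ nth 0%N lam n.
  have [k ->|] := unliftP ord_max j.
    by rewrite AUE /= subrr mul0r eq_sym (negbTE (neq_lift _ _)) mul0r.
  move=> ->; rewrite eqxx mul1r mxE (bigD1 ord_max) //= big1 ?addr0.
    by rewrite !mxE eqxx betaE subnn addn0 ltn_eqF //= mul0r subr0 mulr1.
  by move=> k /negbTE nk; rewrite !mxE nk (ltn_eqF (ltn_ord k)) mul0r subr0 mulr0.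
transitivity (\det (A *m U)); first by rewrite det_mulmx detU mulr1.
rewrite (expand_det_row _ ord_max) (bigD1 ord_max) //= big1 ?addr0; last first.
  by move=> j /negbTE nj; rewrite AUn nj !mul0r.
rewrite AUn eqxx mul1r /cofactor addnn -signr_odd odd_double mul1r.
set B := row' _ _.
have -> : \det B = (\prod_(i < n) (x i - x n)) *
   \det (\matrix_(i < n, j < n) \sum_(k | interlacing lam j k)
     x i ^+ (k + (n - j.+1)) * x n ^+ (nth 0%N lam j - k)).
  pose d := \row_(i < n) (x i - x n).
  have <- : \det (diag_mx d) = \prod_(i < n) (x i - x n).
    by rewrite det_diag; apply: eq_bigr => i _; rewrite mxE.
  rewrite -det_mulmx; congr (\det _); apply/matrixP => i j.
  rewrite mul_diag_mx !mxE.
  have := AUE (lift ord_max i) j; rewrite mxE => ->.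
  by rewrite /= /bump leqNgt ltn_ord add0n.
rewrite mulrCA; congr (_ * _).
(* After transposition the Leibniz products run over the columns, on which the ranges of the sums
   depend. Distributing them selects one [mu j] per column, that is, one interlacing [mu]. *)
rewrite -det_tr /determinant.
rewrite (eq_bigr (fun s : 'S_n => \sum_(mu in family (interlacing lam)) (-1) ^+ s *
    \prod_(i < n) (x (s i) ^+ (mu i + (n - i.+1)) * x n ^+ (nth 0%N lam i - mu i)))).
  rewrite exchange_big /= mulr_sumr; apply: eq_bigr => mu _.
  rewrite /alternant -det_tr /determinant !mulr_sumr; apply: eq_bigr => s _.
  rewrite big_split /=.
  under [X in _ = _ * (_ * X)]eq_bigr do rewrite !mxE /beta tnth_mktuple.
  have mulr4C (p q r u : K) : p * (q * (r * u)) = u * p * (q * r) by ring.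
  exact: mulr4C.
move=> s _; rewrite -mulr_sumr; congr (_ * _).
under eq_bigr do rewrite !mxE.
by rewrite bigA_distr_big_dep.
Qed.

(** * The branching rule for tableaux *)

(** Natural number coordinates allow fillings of different shapes to be compared; outside the
    diagram the value is 0 by default. *)
Definition entry (N : nat) (lam : N.-tuple nat) (n : nat) (T : filling lam n)
    (i j : nat) : nat :=
  if [pick c : cell lam | (crow c == i :> nat) && (ccol c == j :> nat)]
  is Some c then T c else 0%N.

(** There are as many letters as rows, so the row index of a cell can serve as the default letter
    when [f] is out of range. *)
Definition fill (N : nat) (lam : N.-tuple nat) (f : nat -> nat -> nat) :
    filling lam N :=
  [ffun c => insubd (crow c) (f (crow c) (ccol c))].

Section Entries.
Variables (N : nat) (lam : N.-tuple nat).

Lemma cell_inj (c c' : cell lam) :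
  crow c = crow c' :> nat -> ccol c = ccol c' :> nat -> c = c'.
Proof.
move=> /val_inj eq_row /val_inj eq_col; apply: val_inj.
by rewrite [LHS]surjective_pairing [RHS]surjective_pairing; congr pair.
Qed.

Lemma ccol_lt (c : cell lam) : (ccol c < nth 0%N lam (crow c))%N.
Proof. by rewrite -tnth_nth; exact: valP c. Qed.

Lemma cell_at (i j : nat) : is_partition lam -> (j < nth 0%N lam i)%N ->
  exists c : cell lam, crow c = i :> nat /\ ccol c = j :> nat.
Proof.
move=> hlam lt_j.
have lt_i : (i < N)%N.
  by rewrite ltnNge; apply: contraL lt_j => le_Ni; rewrite nth_default ?size_tuple.
have lt_jh : (j < head 0%N lam)%N.
  by rewrite -nth0; apply: leq_trans lt_j (partition_nth _ _).
have hc : ((Ordinal lt_i, Ordinal lt_jh).2 < tnth lam (Ordinal lt_i, Ordinal lt_jh).1)%N.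
  by rewrite (tnth_nth 0%N).
by exists (exist (fun c : 'I_N * 'I_(head 0%N lam) => (c.2 < tnth lam c.1)%N) _ hc).
Qed.

Lemma entryE (n : nat) (T : filling lam n) (c : cell lam) :
  entry T (crow c) (ccol c) = T c.
Proof.
rewrite /entry; case: pickP => [c' /andP[/eqP eq_row /eqP eq_col]|/(_ c)].
  by rewrite (cell_inj eq_row eq_col).
by rewrite !eqxx.
Qed.

Lemma entry_fill (f : nat -> nat -> nat) (i j : nat) : is_partition lam ->
  (j < nth 0%N lam i)%N -> (f i j < N)%N -> entry (fill lam f) i j = f i j.
Proof.
move=> hlam /(cell_at hlam)[c [<- <-]] lt_f.
by rewrite entryE ffunE insubdK.
Qed.

Lemma entry_lt (n : nat) (T : filling lam n) (i j : nat) :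
  is_partition lam -> (j < nth 0%N lam i)%N -> (entry T i j < n)%N.
Proof. by move=> hlam /(cell_at hlam)[c [<- <-]]; rewrite entryE. Qed.

Lemma entry_inj (n : nat) (T T' : filling lam n) :
  (forall i j, (j < nth 0 lam i)%N -> entry T i j = entry T' i j) -> T = T'.
Proof.
move=> eqTT'; apply/ffunP => c; apply: val_inj.
by rewrite /= -!entryE eqTT' // ccol_lt.
Qed.

Lemma SSYT_entryP (n : nat) (T : filling lam n) : is_partition lam ->
  reflect
   ((forall i j j', (j < j')%N -> (j' < nth 0 lam i)%N ->
       (entry T i j <= entry T i j')%N) /\
    (forall i i' j, (i < i')%N -> (j < nth 0 lam i')%N ->
       (entry T i j < entry T i' j)%N))
   (T \in SSYT lam n).
Proof.
move=> hlam; rewrite inE; apply: (iffP forallP) => [hT|[hrow hcol] c].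
  split=> [i j j' lt_jj' lt_j'|i i' j lt_ii' lt_j].
    have [c [row_c col_c]] := cell_at hlam (ltn_trans lt_jj' lt_j').
    have [c' [row_c' col_c']] := cell_at hlam lt_j'.
    have /forallP/(_ c')/andP[/implyP + _] := hT c.
    rewrite -val_eqE /= row_c row_c' col_c col_c' eqxx => /(_ lt_jj').
    by rewrite -!entryE row_c row_c' col_c col_c'.
  have lt_ji := leq_trans lt_j (partition_nth hlam (ltnW lt_ii')).
  have [c [row_c col_c]] := cell_at hlam lt_ji.
  have [c' [row_c' col_c']] := cell_at hlam lt_j.
  have /forallP/(_ c')/andP[_ /implyP] := hT c.
  rewrite -val_eqE /= row_c row_c' col_c col_c' eqxx => /(_ lt_ii').
  by rewrite -!entryE row_c row_c' col_c col_c'.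
apply/forallP => c'; apply/andP; split; apply/implyP => /andP[/eqP eq_cc' lt_cc'].
  by rewrite -!entryE eq_cc'; apply: hrow => //; exact: ccol_lt.
by rewrite -!entryE eq_cc'; apply: hcol => //; exact: ccol_lt.
Qed.

Lemma prod_cells (K : comNzRingType) (F : nat -> nat -> K) : is_partition lam ->
  \prod_(c : cell lam) F (crow c) (ccol c) =
  \prod_(i < N) \prod_(0 <= j < nth 0%N lam i) F i j.
Proof.
move=> hlam.
transitivity (\prod_(i < N) \prod_(j < head 0%N lam | (j < tnth lam i)%N) F i j).
  rewrite pair_big_dep (reindex_omap (val : cell lam -> _) insub) /=; last first.
    by move=> c lt_c; rewrite insubT.
  by apply: eq_bigl => c; rewrite valK eqxx (valP c).
apply: eq_bigr => i _; rewrite (big_nat_widen _ _ (head 0%N lam)) ?big_mkord.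
  by apply: eq_bigl => j; rewrite (tnth_nth 0%N).
by rewrite -nth0 partition_nth.
Qed.

End Entries.

(** * Removal of the boxes with the largest entry *)

Section Branching.
Variables (n : nat) (lam : n.+1.-tuple nat).
Hypothesis hlam : is_partition lam.

Lemma interlacing_bounds (mu : {ffun 'I_n -> 'I_(head 0%N lam).+1}) (i : nat) :
  mu \in family (interlacing lam) ->
  (nth 0 lam i.+1 <= nth 0 (shape_tuple mu) i <= nth 0 lam i)%N.
Proof.
move=> /familyP hmu; have [lt_in|le_ni] := ltnP i n.
  by rewrite (nth_shape_tuple mu (Ordinal lt_in)); exact: hmu (Ordinal lt_in).
rewrite [nth _ lam i.+1]nth_default ?size_tuple //.
by rewrite [nth _ (shape_tuple mu) i]nth_default ?size_tuple.
Qed.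

Lemma shape_tuple_partition (mu : {ffun 'I_n -> 'I_(head 0%N lam).+1}) :
  mu \in family (interlacing lam) -> is_partition (shape_tuple mu).
Proof.
move=> hmu; apply/(sortedP 0%N) => i _ /=.
have /andP[_ le1] := interlacing_bounds i.+1 hmu.
by have /andP[le2 _] := interlacing_bounds i hmu; exact: leq_trans le1 le2.
Qed.

(** On a tableau, the first position in row [i] holding the largest letter [n] is the number of
    smaller entries; [find] returns the row length when there is no such position. *)
Definition restricted_shape (T : filling lam n.+1) :
    {ffun 'I_n -> 'I_(head 0%N lam).+1} :=
  [ffun i : 'I_n => inord (find (fun j => n <= entry T i j)%N (iota 0 (nth 0%N lam i)))].

(** Columns increase strictly from an entry that is at least 0. In particular row [n] holds only the
    letter [n], so that at most [n] rows survive its removal. *)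
Lemma SSYT_row_le_entry (T : filling lam n.+1) (i j : nat) :
  T \in SSYT lam n.+1 -> (j < nth 0 lam i)%N -> (i <= entry T i j)%N.
Proof.
move=> /(SSYT_entryP _ hlam)[_ hcol]; elim: i => // i IHi lt_j.
by apply: leq_ltn_trans (hcol i i.+1 j _ lt_j) => //; apply/IHi/(leq_trans lt_j)/partition_nth.
Qed.

Lemma entry_ltn_restricted_shape (T : filling lam n.+1) (i j : nat) :
  T \in SSYT lam n.+1 -> (j < nth 0 lam i)%N ->
  (entry T i j < n)%N = (j < nth 0 (shape_tuple (restricted_shape T)) i)%N.
Proof.
move=> hT lt_j; have [lt_in|le_ni] := ltnP i n; last first.
  rewrite nth_default ?size_tuple // ltn0 ltnNge.
  by rewrite (leq_trans le_ni) // SSYT_row_le_entry.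
have /(SSYT_entryP _ hlam)[hrow _] := hT.
rewrite (nth_shape_tuple _ (Ordinal lt_in)) ffunE /=.
set p := fun j => _; set s := iota _ _.
have size_s : size s = nth 0%N lam i by rewrite size_iota.
have le_find : (find p s <= nth 0 lam i)%N by rewrite -size_s find_size.
rewrite inordK; last by rewrite ltnS (leq_trans le_find) // -nth0 partition_nth.
have [lt_jf|le_fj] := ltnP j (find p s).
  by have := before_find 0%N lt_jf; rewrite nth_iota // /p add0n ltnNge => ->.
have lt_f := leq_ltn_trans le_fj lt_j.
have : p (nth 0%N s (find p s)) by apply: nth_find; rewrite has_find size_s.
rewrite nth_iota // /p add0n => le_n; apply/negbTE; rewrite -leqNgt.
apply: leq_trans le_n _; move: le_fj; rewrite leq_eqVlt => /predU1P[->//|lt_fj].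
exact: hrow.
Qed.

(** For the lower bound: a cell with another one below it has a strictly smaller entry than that
    one, hence is not filled with [n], and it survives. *)
Lemma restricted_shape_interlacing (T : filling lam n.+1) :
  T \in SSYT lam n.+1 -> restricted_shape T \in family (interlacing lam).
Proof.
move=> hT; apply/familyP => i; rewrite inE -nth_shape_tuple.
have le_shape : (nth 0 (shape_tuple (restricted_shape T)) i <= nth 0 lam i)%N.
  rewrite nth_shape_tuple ffunE inordK.
    by rewrite (leq_trans (find_size _ _)) // size_iota.
  by rewrite ltnS (leq_trans (find_size _ _)) // size_iota -nth0 partition_nth.
rewrite le_shape andbT; case E : (nth 0%N lam i.+1) => [//|j].
have lt_j : (j < nth 0 lam i.+1)%N by rewrite E.
have lt_ji : (j < nth 0 lam i)%N by apply: leq_trans lt_j (partition_nth _ _).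
rewrite -entry_ltn_restricted_shape //.
have /(SSYT_entryP _ hlam)[_ hcol] := hT.
by apply: leq_trans (hcol i i.+1 j _ lt_j) _ => //; rewrite -ltnS entry_lt.
Qed.

Section Extension.
Variable mu : {ffun 'I_n -> 'I_(head 0%N lam).+1}.
Hypothesis hmu : mu \in family (interlacing lam).
Let m := nth 0%N (shape_tuple mu).
Let hpm : is_partition (shape_tuple mu) := shape_tuple_partition hmu.

Definition extend_filling (T : filling (shape_tuple mu) n) : filling lam n.+1 :=
  fill lam (fun i j => if (j < m i)%N then entry T i j else n).

Definition restrict_filling (T : filling lam n.+1) : filling (shape_tuple mu) n :=
  fill (shape_tuple mu) (entry T).

Lemma entry_extend (T : filling (shape_tuple mu) n) (i j : nat) :
  (j < nth 0 lam i)%N ->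
  entry (extend_filling T) i j = if (j < m i)%N then entry T i j else n.
Proof.
by move=> lt_j; rewrite entry_fill //; case: ifP => // lt_jm; apply/ltnW/entry_lt.
Qed.

Lemma extend_fillingK : cancel extend_filling restrict_filling.
Proof.
move=> T; apply: entry_inj => i j lt_j.
have lt_jl : (j < nth 0 lam i)%N.
  by have /andP[_] := interlacing_bounds i hmu; exact: leq_trans.
rewrite entry_fill // entry_extend // /m lt_j //; exact: entry_lt.
Qed.

Lemma restrict_fillingK (T : filling lam n.+1) :
  T \in SSYT lam n.+1 -> restricted_shape T = mu ->
  extend_filling (restrict_filling T) = T.
Proof.
move=> hT shT; apply: entry_inj => i j lt_j.
have := entry_ltn_restricted_shape hT lt_j.
rewrite shT entry_extend // -/m; case: ifP => lt_jm lt_Tn; first by rewrite entry_fill.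
have := entry_lt T hlam lt_j; rewrite ltnS leq_eqVlt lt_Tn orbF.
by move/eqP.
Qed.

(** Interlacing puts at most one added cell in each column, and every cell above it belongs to [mu],
    so the added letters [n] respect strictness. *)
Lemma extend_filling_SSYT (T : filling (shape_tuple mu) n) :
  (extend_filling T \in SSYT lam n.+1) = (T \in SSYT (shape_tuple mu) n).
Proof.
have le_m i : (m i <= nth 0 lam i)%N by have /andP[] := interlacing_bounds i hmu.
have ge_m i : (nth 0 lam i.+1 <= m i)%N by have /andP[] := interlacing_bounds i hmu.
apply/(SSYT_entryP _ hlam)/(SSYT_entryP _ hpm) => -[hrow hcol]; split.
- move=> i j j' lt_jj' lt_j'; have lt_j := ltn_trans lt_jj' lt_j'.
  have := hrow i j j' lt_jj' (leq_trans lt_j' (le_m i)).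
  by rewrite !entry_extend ?(leq_trans _ (le_m i)) // /m lt_j lt_j'.
- move=> i i' j lt_ii' lt_j; have le_ii' := ltnW lt_ii'.
  have := hcol i i' j lt_ii' (leq_trans lt_j (le_m i')).
  have lt_ji : (j < m i)%N by apply: leq_trans lt_j (partition_nth hpm _).
  by rewrite !entry_extend ?(leq_trans lt_ji (le_m i)) ?(leq_trans lt_j (le_m i')) // lt_ji /m lt_j.
- move=> i j j' lt_jj' lt_j'; have lt_j := ltn_trans lt_jj' lt_j'.
  rewrite !entry_extend //; case: (ltnP j' (m i)) => [lt_j'm|_].
    by rewrite (ltn_trans lt_jj' lt_j'm); exact: hrow.
  by case: ifP => // lt_jm; apply/ltnW/entry_lt.
move=> i i' j lt_ii' lt_j.
have lt_jm : (j < m i)%N.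
  by apply: leq_trans lt_j (leq_trans _ (ge_m i)); exact: partition_nth.
have lt_ji := leq_trans lt_jm (le_m i).
rewrite !entry_extend // lt_jm; case: ifP => lt_jm'; first exact: hcol.
exact: entry_lt.
Qed.

Lemma restricted_shape_extend (T : filling (shape_tuple mu) n) :
  T \in SSYT (shape_tuple mu) n -> restricted_shape (extend_filling T) = mu.
Proof.
move=> hT; have hU : extend_filling T \in SSYT lam n.+1 by rewrite extend_filling_SSYT.
have hU' := restricted_shape_interlacing hU.
apply/ffunP => i; apply: val_inj => /=.
have key j : (j < nth 0 lam i)%N ->
    (j < restricted_shape (extend_filling T) i)%N = (j < mu i)%N.
  move=> lt_j; rewrite -!nth_shape_tuple -entry_ltn_restricted_shape //.
  rewrite entry_extend // -/m; case: ifP => [lt_jm|]; last by rewrite ltnn.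
  exact: entry_lt.
have /andP[_ le1] := interlacing_bounds i hU'.
have /andP[_ le2] := interlacing_bounds i hmu.
rewrite !nth_shape_tuple in le1 le2.
apply/eqP; rewrite eqn_leq; apply/andP; split; rewrite leqNgt; apply/negP => lt.
  by have := key _ (leq_trans lt le1); rewrite lt ltnn.
by have := key _ (leq_trans lt le2); rewrite lt ltnn.
Qed.

Lemma prod_extend (K : comNzRingType) (x : nat -> K) (T : filling (shape_tuple mu) n) :
  \prod_c x (extend_filling T c) =
  (\prod_(i < n) x n ^+ (nth 0%N lam i - mu i)) * x n ^+ nth 0%N lam n *
  \prod_c x (T c).
Proof.
under eq_bigr do rewrite -entryE.
under [in RHS]eq_bigr do rewrite -entryE.
rewrite (prod_cells (fun i j => x (entry T i j))) //.
rewrite (prod_cells (fun i j => x (entry (extend_filling T) i j))) //.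
rewrite big_ord_recr /= mulrAC; congr (_ * _).
  rewrite -big_split; apply: eq_bigr => i _ /=.
  have /andP[_ le_m] := interlacing_bounds i hmu.
  rewrite (big_cat_nat _ le_m) //= mulrC; congr (_ * _).
    rewrite -nth_shape_tuple -prodr_const_nat; apply: eq_big_nat => j /andP[le_mj lt_j].
    by rewrite entry_extend // ltnNge le_mj.
  apply: eq_big_nat => j /andP[_ lt_j].
  by rewrite entry_extend ?(leq_trans lt_j) // /m lt_j.
rewrite -[in RHS](subn0 (nth 0%N lam n)) -prodr_const_nat.
apply: eq_big_nat => j /andP[_ lt_j].
by rewrite entry_extend // /m [nth 0%N (shape_tuple mu) n]nth_default ?size_tuple.
Qed.

End Extension.

(** Tableaux are grouped by the shape left after removing [n]; [extend_filling] and
    [restrict_filling] are inverse bijections between each group and the tableaux of shape [mu]. *)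
Lemma SSYT_branching (K : comNzRingType) (x : nat -> K) :
  \sum_(T in SSYT lam n.+1) \prod_c x (T c) =
  \sum_(mu in family (interlacing lam))
     (\prod_(i < n) x n ^+ (nth 0%N lam i - mu i)) * x n ^+ nth 0%N lam n *
     \sum_(T in SSYT (shape_tuple mu) n) \prod_c x (T c).
Proof.
rewrite (partition_big restricted_shape (family (interlacing lam))) /=; last first.
  exact: restricted_shape_interlacing.
apply: eq_bigr => mu hmu; rewrite mulr_sumr.
rewrite (reindex_onto (@extend_filling mu) (@restrict_filling mu)); last first.
  by move=> T /andP[hT /eqP]; exact: restrict_fillingK.
apply: eq_big => [T|T _]; last exact: prod_extend.
rewrite extend_fillingK // eqxx andbT extend_filling_SSYT //.
by apply/andb_idr => hT; rewrite restricted_shape_extend.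
Qed.

End Branching.

(** Induction on the number of variables, by the two branching rules. The product form avoids
    dividing by an alternant that may vanish. *)
Lemma bialternant_formula (K : comNzRingType) (n : nat) (x : nat -> K)
    (lam : n.-tuple nat) : is_partition lam ->
  (\sum_(T in SSYT lam n) \prod_c x (T c)) * alternant x (fun j : 'I_n => n - j.+1)%N =
  alternant x (beta lam).
Proof.
elim: n lam => [|n IHn] lam hlam.
  rewrite /alternant !det_mx00 mulr1.
  (* Without rows there are no cells, hence exactly one filling, of weight 1. *)
  have cellF (c : cell lam) : False by case: (crow c).
  rewrite (big_pred1 [ffun c => False_rect _ (cellF c)]).
    by apply: big1 => c; case: (cellF c).
  move=> T /=; rewrite inE.
  have -> : T = [ffun c => False_rect _ (cellF c)] by apply/ffunP => c; case: (cellF c).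
  by rewrite eqxx; apply/forallP => c; case: (cellF c).
pose lam0 : n.+1.-tuple nat := [tuple 0%N | _ < n.+1].
have nth0 i : nth 0%N lam0 i = 0%N.
  have [lt_i|le_i] := ltnP i n.+1; last by rewrite nth_default ?size_tuple.
  by rewrite -(tnth_nth 0%N lam0 (Ordinal lt_i)) tnth_mktuple.
have hlam0 : is_partition lam0 by apply/(sortedP 0%N) => i _; rewrite !nth0.
(* The denominator is the alternant of the empty partition, with which only the empty partition
   interlaces: branching gives its recursion too. *)
have -> : alternant x (fun j : 'I_n.+1 => n.+1 - j.+1)%N =
    (\prod_(i < n) (x i - x n)) * alternant x (fun j : 'I_n => n - j.+1)%N.
  have -> : alternant x (fun j : 'I_n.+1 => n.+1 - j.+1)%N = alternant x (beta lam0).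
    by congr (\det _); apply/matrixP => i j; rewrite !mxE /beta tnth_mktuple.
  rewrite alternant_branching //; congr (_ * _).
  rewrite (big_pred1 [ffun _ => ord0]) => [|mu].
    rewrite nth0 mulr1 big1 ?mul1r => [|i _]; last by rewrite nth0.
    by congr (\det _); apply/matrixP => i j; rewrite !mxE /beta tnth_mktuple ffunE.
  apply/familyP/eqP => [hmu|-> i]; last by rewrite inE ffunE !nth0.
  apply/ffunP => i; apply: val_inj; rewrite ffunE /=; apply/eqP.
  by have := hmu i; rewrite inE !nth0 leqn0.
rewrite alternant_branching // SSYT_branching // mulrCA; congr (_ * _).
rewrite mulr_suml; apply: eq_bigr => mu hmu.
by rewrite -(IHn _ (shape_tuple_partition hmu)) mulrA.
Qed.

(** * Evaluation of the alternant *)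

(* Both sides compare the signs of the Vandermonde determinants of [0, ..., n-1]
   and of its rearrangement by [s]. *)
Lemma sign_perm_inversions (n : nat) (s : 'S_n) :
  (-1) ^+ s = (-1) ^+ (\sum_(i < n) \sum_(j < n | i < j) (s j < s i))%N :> int.
Proof.
pose a := \row_(j < n) (j : nat)%:Z.
pose b := \row_(j < n) (s j : nat)%:Z.
have Vb : Vandermonde n b = col_perm s (Vandermonde n a).
  by apply/matrixP => i j; rewrite !mxE.
have : \det (Vandermonde n b) = (-1) ^+ s * \det (Vandermonde n a).
  by rewrite Vb col_permE det_mulmx det_perm odd_permV mulrC.
rewrite !det_Vandermonde => /(congr1 (fun k : int => sgz k)).
have sgz_prod (I : finType) (P : pred I) (F : I -> int) :
    sgz (\prod_(i | P i) F i) = \prod_(i | P i) sgz (F i).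
  by elim/big_rec2: _ => [|i k l _ <-]; rewrite ?sgz1 ?sgzM.
rewrite sgzM !sgz_prod [X in _ * X]big1 => [|i _]; last first.
  rewrite sgz_prod; apply: big1 => j lt_ij; apply: gtr0_sgz.
  by rewrite !mxE subr_gt0 ltz_nat.
have -> : sgz ((-1) ^+ s : int) = (-1) ^+ s by case: (odd_perm s).
rewrite mulr1 => <-.
rewrite -prodrXr; apply: eq_bigr => i _; rewrite sgz_prod -prodrXr.
apply: eq_bigr => j lt_ij; rewrite !mxE.
case: (ltngtP (s j) (s i)) => [lt_s|lt_s|/val_inj/perm_inj eq_ij].
- by rewrite ltr0_sgz // subr_lt0 ltz_nat.
- by rewrite gtr0_sgz // subr_gt0 ltz_nat.
by rewrite eq_ij ltnn in lt_ij.
Qed.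

Lemma det_mx22 (R : comNzRingType) (A : 'M[R]_2) :
  \det A = A ord0 ord0 * A ord_max ord_max - A ord0 ord_max * A ord_max ord0.
Proof.
have l0 (j : 'I_1) : lift ord0 j = ord_max :> 'I_2 by apply: val_inj; rewrite ord1.
have l1 (j : 'I_1) : lift ord_max j = ord0 :> 'I_2 by apply: val_inj; rewrite ord1.
rewrite (expand_det_row _ ord0) big_ord_recl big_ord1 /cofactor !det_mx11 !mxE !l0 l1.
by rewrite expr0 expr1 mul1r mulN1r mulrN.
Qed.

(** These properties are common to both cases of the selection. The columns [jA2] and [jB1] may
    coincide, as they do for a class of size 3. *)
Record AB_spec (N : nat) (lam : N.-tuple nat) (t : nat) (s : AB_cols N) : Prop :=
  ABSpec {
    AB_ltA : (jA1 s < jA2 s)%N;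
    AB_ltB : (jB1 s < jB2 s)%N;
    AB_neq : jA1 s != jB1 s;
    AB_modA : beta lam (jA1 s) = beta lam (jA2 s) %[mod t];
    AB_modB : beta lam (jB1 s) = beta lam (jB2 s) %[mod t];
    AB_inj : {in setS s &, injective (fun j => beta lam j %% t)%N} }.

(** * The determinant of the residue matrix *)

Section Determinant.
Variables (K : fieldType) (t : nat) (h : K).
Hypothesis h_neq0 : h != 0.
Hypothesis t_gt0 : (0 < t)%N.
Let z := h ^+ 2.

(** The rows of [z] and [z^-1] come first, so that the indicator rows form the lower blocks. *)
Definition residue_entry (i b : nat) : K :=
  if i is i'.+1 then
    if i' is i''.+1 then (b == i'' %[mod t])%:R else z ^- b
  else z ^+ b.

Definition residue_mx (lam : t.+2.-tuple nat) : 'M[K]_(2 + t) :=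
  \matrix_(i < 2 + t, j < 2 + t) residue_entry i (beta lam j).

Definition two_sinh (d : int) : K := h ^ d - h ^ (- d).

Lemma det_residue_mx_empty_class (lam : t.+2.-tuple nat) :
  has_empty_class lam t -> \det (residue_mx lam) = 0.
Proof.
case/existsP => i /nilP empty_i.
rewrite (expand_det_row _ (rshift 2 i)); apply: big1 => j _.
rewrite mxE /=; case: eqP => [eq_ji|_]; last by rewrite mul0r.
have : j \in class_cols lam t i by rewrite mem_filter mem_enum andbT; apply/eqP.
by rewrite empty_i.
Qed.

Section Selected.
Variables (lam : t.+2.-tuple nat) (s : AB_cols t.+2).
Hypothesis hs : AB_spec lam t s.
Let N := (2 + t)%N.
Let res (j : 'I_N) := (beta lam j %% t)%N.

Lemma in_setS (j : 'I_N) : (j \in setS s) = (j != jA1 s) && (j != jB1 s).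
Proof. by rewrite !inE negb_or. Qed.

(* The word of residues on [S], preceded by the columns [jA1] and [jB1]: sorting
   the columns by this key makes [residue_mx] block triangular. *)
Definition col_key (j : 'I_N) : 'I_N :=
  if j == jA1 s then lshift t ord0 else
  if j == jB1 s then lshift t ord_max else rshift 2 (Ordinal (ltn_pmod (beta lam j) t_gt0)).

Lemma val_col_key (j : 'I_N) : col_key j =
  (if j == jA1 s then 0 else if j == jB1 s then 1 else (res j).+2)%N :> nat.
Proof. by rewrite /col_key; do 2?case: ifP. Qed.

Lemma col_key_inj : injective col_key.
Proof.
move=> i j /(congr1 val); rewrite /= !val_col_key.
have [->|iA] := eqVneq i (jA1 s); have [->|jA] := eqVneq j (jA1 s) => //.
- by case: ifP.
- by case: ifP.
have [->|iB] := eqVneq i (jB1 s); have [->|jB] := eqVneq j (jB1 s) => // -[eq_res].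
by apply: (AB_inj hs) => //; rewrite in_setS ?iA ?jA.
Qed.

Let p : 'S_N := perm col_key_inj.

(** Having key 0, column [jA1] is inverted with all the [jA1] columns on its left; so is [jB1], of
    key 1, except with [jA1] when that lies on its left. The other inversions are those of the word
    on [S]. *)
Lemma col_key_inversions :
  (\sum_(i < N) \sum_(j < N | i < j) (p j < p i) + (jA1 s < jB1 s) =
   inv_bS lam t s + jA1 s + jB1 s)%N.
Proof.
have sum_below (k : 'I_N) : (\sum_(i < N) \sum_(j < N | i < j) (j == k) = k)%N.
  rewrite (exchange_big_dep predT) //= (bigD1 k) //= [X in (_ + X)%N]big1 ?addn0; last first.
    by move=> j /negbTE njk; rewrite big1 // => i _; rewrite njk.
  rewrite (eq_bigr (fun _ => 1%N)) => [|i _]; last by rewrite eqxx.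
  by rewrite -(big_ord_widen _ (fun=> 1%N)) ?sum1_card ?card_ord // ltnW.
have -> : inv_bS lam t s = (\sum_(i < N) \sum_(j < N | i < j)
    [&& i \in setS s, j \in setS s & res j < res i])%N.
  rewrite /inv_bS -sum1dep_card pair_big_dep /= [RHS]big_mkcond [LHS]big_mkcond.
  apply: eq_bigr => -[i j] _ /=.
  by case: (i \in _); case: (j \in _); case: (i < j)%N.
have -> : (jA1 s < jB1 s)%N =
    (\sum_(i < N) \sum_(j < N | i < j) ((i == jA1 s) && (j == jB1 s)))%N :> nat.
  rewrite (bigD1 (jA1 s)) //= [X in (_ + X)%N]big1 ?addn0; last first.
    by move=> i /negbTE niA; apply: big1 => j _; rewrite niA.
  rewrite eqxx big_mkcond (bigD1 (jB1 s)) //= big1 ?addn0 ?eqxx; first by case: ifP.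
  by move=> j /negbTE njB; rewrite njB; case: ifP.
rewrite -(sum_below (jA1 s)) -(sum_below (jB1 s)) -!big_split.
apply: eq_bigr => i _; rewrite -!big_split; apply: eq_bigr => j lt_ij /=.
rewrite !permE !val_col_key !in_setS.
have neqAB := negbTE (AB_neq hs).
have nij : (i == j) = false by rewrite -val_eqE ltn_eqF.
have [ejA|jA] := eqVneq j (jA1 s).
  by rewrite ejA in nij *; rewrite nij neqAB !andbF; case: ifP.
have [ejB|jB] := eqVneq j (jB1 s).
  by rewrite ejB in nij *; rewrite nij !andbF andbT; case: ifP.
rewrite !andbF !addn0; by case: ifP => //= _; case: ifP.
Qed.


(** Since [z ^+ a1 - z ^+ a2] is [h ^+ (a1 + a2)] times [two_sinh (a1 - a2)], and similarly for the
    other differences, both products share two factors, and what remains is a third [two_sinh]. *)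
Lemma two_sinh_minor (a1 a2 b1 b2 : nat) :
  (z ^+ a1 - z ^+ a2) * (z ^- b1 - z ^- b2) - (z ^+ b1 - z ^+ b2) * (z ^- a1 - z ^- a2) =
  - (two_sinh (a1%:Z - a2%:Z) * two_sinh (b1%:Z - b2%:Z) *
     two_sinh (a1%:Z + a2%:Z - b1%:Z - b2%:Z)).
Proof.
have hpow n : h ^+ n != 0 by rewrite expf_neq0.
rewrite /two_sinh !opprB !opprD !expfzDr // -!exprnP -!exprnN /z -!exprM !(mulnC 2) !exprM.
move: (hpow a1) (hpow a2) (hpow b1) (hpow b2).
move: (h ^+ a1) (h ^+ a2) (h ^+ b1) (h ^+ b2) => A1 A2 B1 B2 nA1 nA2 nB1 nB2.
by field; rewrite nA1 nA2 nB1 nB2.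
Qed.

Lemma beta_decreasing (i j : 'I_N) : is_partition lam -> (i < j)%N ->
  (beta lam j < beta lam i)%N.
Proof.
move=> hlam lt_ij; rewrite /beta !(tnth_nth 0%N).
rewrite -addnS leq_add ?partition_nth ?ltn_sub2l ?ltnS //; first exact: ltnW.
by rewrite -ltnS (leq_trans lt_ij) // -ltnS; exact: ltn_ord j.
Qed.

Lemma det_residue_mx : is_partition lam -> 
  \det (residue_mx lam) =
  ((-1) ^+ (jA1 s + jB1 s + inv_bS lam t s) *
   sgz ((beta lam (jA1 s))%:Z - (beta lam (jB1 s))%:Z))%:~R *
  (two_sinh (d1 lam s) * two_sinh (d2 lam s) * two_sinh (d3t lam s)).
Proof.
move=> hlam; set D := residue_mx lam.
(* [U] subtracts column [jA2] from [jA1] and [jB2] from [jB1]. It is unitriangular because both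
   subtracted columns lie further right, even when [jA2 = jB1]. *)
pose U : 'M[K]_(2 + t) := \matrix_(k, j) ((k == j)%:R
  - ((j == jA1 s) && (k == jA2 s))%:R - ((j == jB1 s) && (k == jB2 s))%:R).
have notA (k j : 'I_N) : (k <= j)%N -> (j == jA1 s) && (k == jA2 s) = false.
  move=> le_kj; apply/negP => /andP[/eqP ej /eqP ek].
  by have := AB_ltA hs; rewrite -ej -ek ltnNge le_kj.
have notB (k j : 'I_N) : (k <= j)%N -> (j == jB1 s) && (k == jB2 s) = false.
  move=> le_kj; apply/negP => /andP[/eqP ej /eqP ek].
  by have := AB_ltB hs; rewrite -ej -ek ltnNge le_kj.
have detU : \det U = 1.
  rewrite det_trig; first by apply: big1 => i _; rewrite mxE eqxx notA ?notB // !subr0.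
  apply/is_trig_mxP => k j lt_kj.
  by rewrite mxE -val_eqE (ltn_eqF lt_kj) notA ?notB ?subr0 // ltnW.
have DUE i j : (D *m U) i j = D i j - (j == jA1 s)%:R * D i (jA2 s)
    - (j == jB1 s)%:R * D i (jB2 s).
  rewrite mxE; under eq_bigr do rewrite [U _ _]mxE !mulrBr.
  rewrite !sumrB (bigD1 j) //= eqxx mulr1 big1 ?addr0; last first.
    by move=> k /negbTE->; rewrite mulr0.
  rewrite (bigD1 (jA2 s)) //= eqxx andbT [X in _ - (_ + X)]big1 ?addr0; last first.
    by move=> k /negbTE->; rewrite andbF mulr0.
  rewrite (bigD1 (jB2 s)) //= eqxx andbT [X in _ - (_ + X)]big1 ?addr0; last first.
    by move=> k /negbTE->; rewrite andbF mulr0.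
  by rewrite ![D _ _ * _%:R]mulrC.
pose E : 'M[K]_(2 + t) := col_perm p^-1%g (D *m U).
have DUE' : D *m U = col_perm p E by apply/matrixP => i j; rewrite !mxE permK.
have pA : p (jA1 s) = lshift t ord0 by rewrite permE /col_key eqxx.
have pB : p (jB1 s) = lshift t ord_max.
  by rewrite permE /col_key eqxx eq_sym (negbTE (AB_neq hs)).
have Ep i j : E i (p j) = (D *m U) i j by rewrite mxE permK.
have E0 i : E i (lshift t ord0) = D i (jA1 s) - D i (jA2 s).
  by rewrite -pA Ep DUE eqxx (negbTE (AB_neq hs)) mul0r subr0 mul1r.
have E1 i : E i (lshift t ord_max) = D i (jB1 s) - D i (jB2 s).
  by rewrite -pB Ep DUE eqxx eq_sym (negbTE (AB_neq hs)) mul0r subr0 mul1r.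
(* Congruent columns have the same indicators, which cancel in the differences. *)
have dl0 : dlsubmx E = 0.
  apply/matrixP => i j; rewrite 2!mxE [RHS]mxE.
  have [->|->] : j = ord0 \/ j = ord_max.
    by case: j => -[|[|//]] ?; [left|right]; exact: val_inj.
  - by rewrite E0 !mxE /= (AB_modA hs) subrr.
  - by rewrite E1 !mxE /= (AB_modB hs) subrr.
(* Sorted by key, the column at place [k] of the right block is the one in [S] with residue [k]. *)
have dr1 : drsubmx E = 1%:M.
  apply/matrixP => i k; rewrite 2!mxE [RHS]mxE -[rshift 2 k](permKV p).
  set j := p^-1%g (rshift 2 k); rewrite Ep DUE.
  have pj : p j = rshift 2 k by rewrite permKV.
  have jA : (j == jA1 s) = false by apply: contra_eqF pj => /eqP->; rewrite pA.
  have jB : (j == jB1 s) = false by apply: contra_eqF pj => /eqP->; rewrite pB.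
  rewrite jA jB !mul0r !subr0 mxE /=.
  have := congr1 (@nat_of_ord _) pj; rewrite permE val_col_key jA jB /= => -[res_j].
  by rewrite -/(res j) res_j !add0n modn_small // eq_sym.
have detE : \det E = - (two_sinh (d1 lam s) * two_sinh (d2 lam s) * two_sinh (d3t lam s)).
  rewrite -[E]submxK dl0 det_ublock dr1 det1 mulr1 -two_sinh_minor.
  by rewrite det_mx22; congr (_ * _ - _ * _); rewrite 2!mxE ?E0 ?E1 !mxE.
(* As [beta] decreases, the comparison of the columns [jA1] and [jB1] is opposite to that of [a1]
   and [b1]. *)
have sgn_ab : (-1) ^+ (jA1 s < jB1 s) =
    - sgz ((beta lam (jA1 s))%:Z - (beta lam (jB1 s))%:Z).
  case: (ltngtP (jA1 s) (jB1 s)) => [lt_AB|lt_BA|/val_inj eq_AB].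
  - by rewrite gtr0_sgz // subr_gt0 ltz_nat beta_decreasing.
  - by rewrite ltr0_sgz ?opprK // subr_lt0 ltz_nat beta_decreasing.
  by have := AB_neq hs; rewrite eq_AB eqxx.
transitivity (\det (D *m U)); first by rewrite det_mulmx detU mulr1.
rewrite DUE' col_permE det_mulmx det_perm odd_permV detE.
rewrite -(rmorph_sign (intr : int -> K)) sign_perm_inversions mulNr mulrC -mulNr -rmorphN.
congr (_%:~R * _).
have -> : (jA1 s + jB1 s + inv_bS lam t s = inv_bS lam t s + jA1 s + jB1 s)%N by ring.
rewrite -col_key_inversions exprD -mulrA -[sgz _]opprK -sgn_ab.
by rewrite mulrN -expr2 sqrr_sign mulrN mulr1.
Qed.

End Selected.
End Determinant.

(** Orthogonality of characters: a geometric sum whose ratio [u] is either 1 or another [t]-th root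
    of unity. A primitive root of order [t] makes [t] invertible in [K]. *)
Lemma sum_prim_root (K : fieldType) (t : nat) (w : K) (b r : nat) :
  t.-primitive_root w ->
  \sum_(k < t) (w ^+ k) ^+ b * (w ^- r) ^+ k / t%:R = (b == r %[mod t])%:R.
Proof.
move=> prim_w; have w_neq0 : w ^+ r != 0.
  by rewrite expf_neq0 // (prim_root_eq0 prim_w) -lt0n (prim_order_gt0 prim_w).
under eq_bigr do rewrite exprAC -exprMn.
rewrite -mulr_suml -(eq_prim_root_expr prim_w); set u := w ^+ b / w ^+ r.
have -> : (w ^+ b == w ^+ r) = (u == 1).
  rewrite -subr_eq0 -[RHS]subr_eq0 -[in RHS](divff w_neq0) -mulrBl mulf_eq0.
  by rewrite invr_eq0 (negbTE w_neq0) orbF.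
have [->|u_neq1] := eqVneq u 1.
  rewrite (eq_bigr (fun=> 1)) => [|k _]; last by rewrite expr1n.
  by rewrite sumr_const card_ord divff // (prim_root_natf_neq0 prim_w).
have : u ^+ t - 1 = 0.
  rewrite exprMn exprVn -!exprM ![(_ * t)%N]mulnC !exprM (prim_expr_order prim_w).
  by rewrite !expr1n invr1 mulr1 subrr.
rewrite subrX1 => /eqP; rewrite mulf_eq0 subr_eq0 (negbTE u_neq1) => /eqP->.
by rewrite mul0r.
Qed.

(** * Fourier transform and comparison with the empty partition *)

Section Evaluation.
Variables (K : fieldType) (t : nat) (h w : K).
Hypothesis h_neq0 : h != 0.
Hypothesis t_ge2 : (2 <= t)%N.
Hypothesis prim_w : t.-primitive_root w.
Let z := h ^+ 2.
Let t_gt0 : (0 < t)%N := ltnW t_ge2.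

Definition spec_point (i : nat) : K :=
  if (i < t)%N then w ^+ i else if i == t then z else z^-1.

(* The inverse discrete Fourier transform of the first [t] rows, preceded by the
   last two rows. *)
Definition dft_mx : 'M[K]_(2 + t) :=
  \matrix_(i < 2 + t, k < 2 + t)
    if (i : nat) is i'.+1 then
      if i' is i''.+1 then
        if (k < t)%N then (w ^- i'') ^+ k / t%:R else 0
      else (k == t.+1 :> nat)%:R
    else (k == t :> nat)%:R.

Lemma dft_alternant (lam : t.+2.-tuple nat) :
  \det dft_mx * alternant spec_point (beta lam) = \det (residue_mx h lam).
Proof.
rewrite /alternant -det_mulmx; congr (\det _); apply/matrixP => i j.
rewrite !mxE; under eq_bigr do rewrite !mxE.
rewrite !big_ord_recr /= /spec_point !ltnn !ltnNge leqnSn eqxx /=.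
rewrite [t.+1 == t]gtn_eqF // [t == t.+1]ltn_eqF //.
case: i => -[|[|i]] lt_i /=.
- rewrite big1 ?add0r ?mul1r ?mul0r ?addr0 // => k _.
  by rewrite ltn_eqF ?mul0r.
- rewrite big1 ?add0r ?mul0r ?add0r ?eqxx ?mul1r ?exprVn // => k _.
  by rewrite ltn_eqF ?mul0r // ltnW // ltnS.
rewrite !mul0r !addr0 -(sum_prim_root _ _ prim_w); apply: eq_bigr => k _.
by rewrite ltn_ord mulrC mulrA.
Qed.

Definition empty_partition : t.+2.-tuple nat := [tuple 0%N | _ < t.+2].

Lemma beta_empty_partition (j : 'I_t.+2) :
  beta empty_partition j = (t.+1 - j)%N.
Proof. by rewrite /beta tnth_mktuple subSS. Qed.

Lemma empty_partitionP : is_partition empty_partition.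
Proof.
have nth0 i : nth 0%N empty_partition i = 0%N.
  have [lt_i|le_i] := ltnP i t.+2; last by rewrite nth_default ?size_tuple.
  by rewrite -(tnth_nth 0%N _ (Ordinal lt_i)) tnth_mktuple.
by apply/(sortedP 0%N) => i _; rewrite !nth0.
Qed.

(* The beta-set is {t+1, ..., 0}, with A = {t, 0} and B = {t+1, 1}. *)
Definition AB_empty : AB_cols t.+2 := ABCols (inord 1) ord_max ord0 (inord t).

Lemma AB_empty_spec : AB_spec empty_partition t AB_empty.
Proof.
have v1 : (inord 1 : 'I_t.+2) = 1%N :> nat by rewrite inordK.
have vt : (inord t : 'I_t.+2) = t :> nat by rewrite inordK.
split; rewrite ?beta_empty_partition /= ?v1 ?vt //.
- by rewrite -val_eqE /= v1.
- by rewrite subn1 subnn /= modnn mod0n.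
- by rewrite subn0 subSnn -addn1 modnDl.
move=> i j; rewrite !in_setS /= -!val_eqE /= v1 !beta_empty_partition.
move=> /andP[i1 i0] /andP[j1 j0].
have ge2 (k : nat) : (k != 1 -> k != 0 -> 2 <= k)%N by case: k => [|[]].
have lt_t (k : nat) : (2 <= k -> t.+1 - k < t)%N by lia.
rewrite !modn_small ?lt_t ?ge2 //; have := ltn_ord i; have := ltn_ord j => lt_j lt_i.
by move=> eq_ij; apply: val_inj => /=; lia.
Qed.

(** On [S], that is, on the columns from 2 on, the residues are [t-1, ..., 0]: every pair is an
    inversion. *)
Lemma inv_bS_empty : inv_bS empty_partition t AB_empty = 'C(t, 2).
Proof.
have v1 : (inord 1 : 'I_t.+2) = 1%N :> nat by rewrite inordK.
transitivity (\sum_(j < t.+2) (j - 2))%N; last first.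
  rewrite 2!big_ord_recl /= !add0n -triangular_sum big_mkord; apply: eq_bigr => i _.
  by rewrite /= /bump !add1n !subSS subn0.
rewrite /inv_bS -sum1dep_card.
transitivity (\sum_(j < t.+2) \sum_(i < t.+2 | (2 <= i < j)%N) 1)%N; last first.
  apply: eq_bigr => j _.
  rewrite -(big_ord_widen_cond _ (fun i => 2 <= i)%N (fun=> 1%N)) 1?ltnW //.
  by have := big_geq_mkord 2 j predT (fun=> 1%N) => /= <-; rewrite sum_nat_const_nat muln1.
rewrite (exchange_big_dep predT) //= pair_big_dep /=; apply: eq_bigl => -[i j] /=.
rewrite !in_setS /= -!val_eqE /= v1 !beta_empty_partition.
have ge2 (k : nat) : (k != 1)%N && (k != 0)%N = (2 <= k)%N by case: k => [|[]].
rewrite !ge2; have [le2i|] := ltnP 1 i => //=; have [lt_ij|] := ltnP i j; rewrite ?andbF //.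
have lt_t (k : nat) : (2 <= k -> t.+1 - k < t)%N by lia.
rewrite !modn_small ?lt_t ?(ltn_trans le2i lt_ij) //=.
by rewrite ltn_sub2l // (leq_trans lt_ij) // -ltnS ltn_ord.
Qed.

Local Notation sh := (two_sinh h).

Lemma two_sinhN (d : int) : sh (- d) = - sh d.
Proof. by rewrite /two_sinh opprK opprB. Qed.

Lemma two_sinh_abs (d : int) : (sgz d)%:~R * sh `|d| = sh d.
Proof.
have [d_gt0|d_lt0|->] := ltrgt0P d.
- by rewrite gtr0_sgz // mul1r.
- by rewrite ltr0_sgz // mulN1r two_sinhN opprK.
by rewrite sgz0 mul0r /two_sinh oppr0 subrr.
Qed.

(** The sign of [d3t] moves into [eps], and numbering columns from 1 instead of 0 changes the
    exponent by 2. *)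
Lemma sign_det_residue_mx (lam : t.+2.-tuple nat) (s : AB_cols t.+2) :
  is_partition lam -> AB_spec lam t s ->
  (-1) ^+ (t + 'C(t.+3, 2)) * \det (residue_mx h lam) =
  (eps lam t s)%:~R * (sh (d1 lam s) * sh (d2 lam s) * sh (d3 lam s)).
Proof.
move=> hlam hs; rewrite (det_residue_mx h_neq0 t_gt0 hs hlam) /eps.
rewrite -(two_sinh_abs (d3t lam s)) -/(d3 lam s).
rewrite addSn addnS !addSn !exprS !mulN1r opprK !rmorphM /= !rmorph_sign.
have mulr6C (a b c d u v r : K) :
  a * (b * c * (u * v * (d * r))) = a * b * c * d * (u * v * r) by ring.
exact: mulr6C.
Qed.

Lemma eps_empty : eps empty_partition t AB_empty = 1.
Proof.
have v1 : (inord 1 : 'I_t.+2) = 1%N :> nat by rewrite inordK.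
have vt : (inord t : 'I_t.+2) = t :> nat by rewrite inordK.
rewrite /eps /d3t !beta_empty_partition /= v1 vt inv_bS_empty.
rewrite subn1 subn0 subnn subSnn /=.
rewrite (_ : t%:Z - t.+1%:Z = -1); last by lia.
rewrite (_ : t%:Z + 0%:Z - t.+1%:Z - 1%:Z = -2); last by lia.
(* The summands 2 and 1 are the columns of [a1] and [b1] numbered from 1. The two [sgz] factors are
   both -1 and cancel. *)
have even_exponent : (t + 'C(t.+3, 2) + (2 + 1 + 'C(t, 2)) = (2 * t + 'C(t, 2) + 3).*2)%N.
  by rewrite !binS !bin1 !bin0; lia.
by rewrite -exprD even_exponent -signr_odd odd_double.
Qed.

(** [\det dft_mx] multiplies both alternants of the bialternant formula, so its value is never
    computed. *)
Lemma sum_SSYT_det (lam : t.+2.-tuple nat) : is_partition lam ->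
  (\sum_(T in SSYT lam t.+2) \prod_c spec_point (T c)) *
    \det (residue_mx h empty_partition) = \det (residue_mx h lam).
Proof.
move=> hlam; rewrite -!dft_alternant mulrCA; congr (_ * _).
rewrite -(bialternant_formula spec_point hlam); congr (_ * \det _).
by apply/matrixP => i j; rewrite !mxE beta_empty_partition subSS.
Qed.

Hypotheses (sh_t_neq0 : sh t != 0) (sh_2_neq0 : sh 2 != 0).

(** This is the denominator of the theorem, up to powers of 2: the empty partition has [d1 = d2 = t]
    and [d3 = 2]. *)
Lemma sign_det_residue_mx_empty :
  (-1) ^+ (t + 'C(t.+3, 2)) * \det (residue_mx h empty_partition) = sh t ^+ 2 * sh 2.
Proof.
rewrite (sign_det_residue_mx empty_partitionP AB_empty_spec) eps_empty mul1r.
have v1 : (inord 1 : 'I_t.+2) = 1%N :> nat by rewrite inordK.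
have vt : (inord t : 'I_t.+2) = t :> nat by rewrite inordK.
rewrite /d1 /d2 /d3 /d3t !beta_empty_partition /= v1 vt subn1 subn0 subnn subSnn /=.
rewrite (_ : t%:Z - 0%:Z = t); last by lia.
rewrite (_ : t.+1%:Z - 1%:Z = t); last by lia.
rewrite (_ : t%:Z - t.+1%:Z - 1%:Z = -2); last by lia.
by rewrite expr2.
Qed.

Lemma sum_SSYT_empty_class (lam : t.+2.-tuple nat) :
  is_partition lam -> has_empty_class lam t ->
  \sum_(T in SSYT lam t.+2) \prod_c spec_point (T c) = 0.
Proof.
move=> hlam /(det_residue_mx_empty_class h) det0.
have := sum_SSYT_det hlam; rewrite det0 => /eqP; rewrite mulf_eq0 => /orP[/eqP//|/eqP det_e0].
have := sign_det_residue_mx_empty; rewrite det_e0 mulr0 => /esym/eqP.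
by rewrite mulf_eq0 expf_eq0 (negbTE sh_t_neq0) (negbTE sh_2_neq0).
Qed.

Lemma sum_SSYT_AB (lam : t.+2.-tuple nat) (s : AB_cols t.+2) :
  is_partition lam -> AB_spec lam t s ->
  \sum_(T in SSYT lam t.+2) \prod_c spec_point (T c) =
  (eps lam t s)%:~R *
    (sh (d1 lam s) * sh (d2 lam s) * sh (d3 lam s) / (sh t ^+ 2 * sh 2)).
Proof.
move=> hlam hs; rewrite mulrA -sign_det_residue_mx // -sum_SSYT_det //.
by rewrite mulrCA sign_det_residue_mx_empty mulfK // mulf_neq0 // expf_neq0.
Qed.

End Evaluation.

(** * The columns selected by the residue classes *)

(** The excesses of the sizes over 1 add up to 2, which is either 1 + 1 or a single 2. *)
Lemma filter_size_gt1 (T : Type) (ss : seq (seq T)) :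
  all (fun s => 0 < size s)%N ss -> sumn (map size ss) = (size ss).+2 ->
  (exists a1 a2 b1 b2,
     [seq s <- ss | 1 < size s]%N = [:: [:: a1; a2]; [:: b1; b2]]) \/
  (exists p q r, [seq s <- ss | 1 < size s]%N = [:: [:: p; q; r]]).
Proof.
move=> pos_ss sum_ss; set F := filter _ _.
have : sumn (map (fun s => (size s).-1) F) = 2.
  have : (sumn (map size ss) = sumn (map (fun s => (size s).-1) F) + size ss)%N.
    rewrite /F {F sum_ss}; elim: ss pos_ss => //= s ss IHss /andP[s_gt0 /IHss->].
    by case: ifP => /=; lia.
  lia.
have : all (fun s => 1 < size s)%N F by exact: filter_all.
case: F => [|f1 [|f2 F]] //= => [/andP[f1_gt1 _]|/and3P[f1_gt1 f2_gt1 F_gt1]].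
  case: f1 f1_gt1 => [|p [|q [|r [|? ?]]]] //= _ _.
  by right; exists p, q, r.
case: F F_gt1 => [_|f3 F /=/andP[f3_gt1 _]]; last by lia.
case: f1 f1_gt1 => [|a1 [|a2 [|? ?]]] //= _; case: f2 f2_gt1 => [|b1 [|b2 [|? ?]]] //= _;
  try by lia.
by left; exists a1, a2, b1, b2.
Qed.

Section Selection.
Variables (t : nat) (lam : t.+2.-tuple nat).
Hypothesis t_gt0 : (0 < t)%N.
Hypothesis nonempty : ~~ has_empty_class lam t.

Lemma class_cols_sorted (i : nat) : sorted (fun j k : 'I_t.+2 => (j < k)%N) (class_cols lam t i).
Proof.
apply: sorted_filter; first by move=> j k l; exact: ltn_trans.
rewrite -[sorted _ _]/(sorted (relpre (@nat_of_ord t.+2) ltn) _) -sorted_map.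
by rewrite val_enum_ord iota_ltn_sorted.
Qed.

Lemma mem_class_cols (i : nat) (j : 'I_t.+2) :
  (j \in class_cols lam t i) = (beta lam j == i %[mod t]).
Proof. by rewrite mem_filter mem_enum andbT. Qed.

Let classes := [seq class_cols lam t i | i <- iota 0 t].

Lemma sum_size_classes : sumn (map size classes) = t.+2.
Proof.
rewrite /classes -map_comp sumnE big_map -[t in iota 0 t]subn0.
rewrite -[LHS]/(\sum_(0 <= i < t) size (class_cols lam t i))%N big_mkord.
rewrite -[RHS](card_ord t.+2) -sum1_card.
rewrite (partition_big (fun j : 'I_t.+2 => Ordinal (ltn_pmod (beta lam j) t_gt0)) predT) //=.
apply: eq_bigr => i _; rewrite sum1_card.
have cols_uniq : uniq (class_cols lam t i) by rewrite filter_uniq ?enum_uniq.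
rewrite -(card_uniqP cols_uniq); apply: eq_card => j.
by rewrite mem_class_cols [RHS]unfold_in [(i %% t)%N]modn_small.
Qed.

Lemma select_AB_spec : exists s, select_AB lam t = Some s /\ AB_spec lam t s.
Proof.
have pos : all (fun cl => 0 < size cl)%N classes.
  rewrite all_map; apply/allP => i; rewrite mem_iota /= => lt_it.
  rewrite lt0n; apply: contra nonempty => empty_i.
  by apply/existsP; exists (Ordinal lt_it).
have sum_cl : sumn (map size classes) = (size classes).+2.
  by rewrite sum_size_classes size_map size_iota.
have big_class (cl : seq 'I_t.+2) :
    cl \in [seq cl <- classes | 1 < size cl]%N -> exists i, cl = class_cols lam t i.
  by rewrite mem_filter => /andP[_ /mapP[i _ eq_cl]]; exists i.
have ltP (i : nat) (j k : 'I_t.+2) cl : [:: j, k & cl] = class_cols lam t i -> (j < k)%N.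
  by move=> E; have := class_cols_sorted i; rewrite -E => /andP[].
have modP (i : nat) (j k : 'I_t.+2) cl : cl = class_cols lam t i -> j \in cl -> k \in cl ->
    beta lam j = beta lam k %[mod t].
  by move=> ->; rewrite !mem_class_cols => /eqP-> /eqP->.
(* Distinct columns with equal residues lie in a selected class, whence injectivity on [S], which
   meets each such class in at most one column. *)
have same_class (j k : 'I_t.+2) : j != k -> (beta lam j %% t = beta lam k %% t)%N ->
    exists2 cl, cl \in [seq cl <- classes | 1 < size cl]%N & (j \in cl) && (k \in cl).
  move=> neq_jk eq_jk; pose i := (beta lam j %% t)%N.
  have ji : j \in class_cols lam t i by rewrite mem_class_cols modn_mod.
  have ki : k \in class_cols lam t i by rewrite mem_class_cols modn_mod -eq_jk.
  exists (class_cols lam t i); last by rewrite ji.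
  rewrite mem_filter map_f ?mem_iota ?ltn_pmod // andbT ltnNge.
  apply: contra neq_jk => le1; move: ji ki le1.
  by case: (class_cols lam t i) => [|l [|//]] //; rewrite !inE => /eqP-> /eqP->.
rewrite /select_AB -/classes.
have [[a1 [a2 [b1 [b2 E]]]]|[p [q [r E]]]] := filter_size_gt1 pos sum_cl.
  rewrite E in big_class same_class *.
  exists (ABCols a1 a2 b1 b2); split=> //.
  have [iA EA] := big_class [:: a1; a2] (mem_head _ _).
  have [iB EB] : exists i, [:: b1; b2] = class_cols lam t i.
    by apply: big_class; rewrite !inE eqxx orbT.
  have inj : {in setS (ABCols a1 a2 b1 b2) &, injective (fun j => beta lam j %% t)%N}.
    move=> j k; rewrite !in_setS /= => /andP[jA jB] /andP[kA kB] eq_jk.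
    apply/eqP; apply: contraT => neq_jk; have [cl] := same_class _ _ neq_jk eq_jk.
    rewrite !inE => /orP[] /eqP->; rewrite !inE.
      rewrite (negbTE jA) (negbTE kA) => /andP[/eqP ej /eqP ek].
      by rewrite ej ek eqxx in neq_jk.
    rewrite (negbTE jB) (negbTE kB) => /andP[/eqP ej /eqP ek].
    by rewrite ej ek eqxx in neq_jk.
  split=> //=.
  - exact: ltP EA.
  - exact: ltP EB.
  (* Pigeonhole: if [a1 = b1], the residues would be injective on the [t.+1] columns other than
     [a1]. *)
  - apply/eqP => eq_ab; rewrite -eq_ab in inj.
    pose f (j : 'I_t.+2) := Ordinal (ltn_pmod (beta lam j) t_gt0).
    have f_inj : {in ~: [set a1] &, injective f}.
      by move=> j k jS kS [eq_jk]; apply: inj => //; rewrite /setS /= setUid.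
    have := max_card (mem [set f j | j in ~: [set a1]]).
    by rewrite card_in_imset // cardsC1 !card_ord ltnn.
  - by apply: (modP _ _ _ _ EA); rewrite !inE eqxx ?orbT.
  by apply: (modP _ _ _ _ EB); rewrite !inE eqxx ?orbT.
rewrite E in big_class same_class *.
exists (ABCols p q q r); split=> //.
have [i Ei] := big_class [:: p; q; r] (mem_head _ _).
have lt_pq := ltP _ _ _ _ Ei.
have lt_qr : (q < r)%N by have := class_cols_sorted i; rewrite -Ei => /and3P[].
split=> //=.
- by rewrite -val_eqE ltn_eqF.
- by apply: (modP _ _ _ _ Ei); rewrite !inE eqxx ?orbT.
- by apply: (modP _ _ _ _ Ei); rewrite !inE eqxx ?orbT.
move=> j k; rewrite !in_setS /= => /andP[jp jq] /andP[kp kq] eq_jk.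
apply/eqP; apply: contraT => neq_jk; have [cl] := same_class _ _ neq_jk eq_jk.
rewrite !inE => /eqP->.
rewrite !inE (negbTE jp) (negbTE kp) (negbTE jq) (negbTE kq) => /andP[/eqP ej /eqP ek].
by rewrite ej ek eqxx in neq_jk.
Qed.
End Selection.

(** * Specialization to the field of rational functions *)

Lemma halved_ratio (K : fieldType) (a b c u v : K) :
  2 != 0 :> K -> u != 0 -> v != 0 ->
  a / 2 * (b / 2) * (c / 2) / ((u / 2) ^+ 2 * (v / 2)) = a * b * c / (u ^+ 2 * v).
Proof. by move=> two_neq0 u_neq0 v_neq0; field; rewrite two_neq0 u_neq0 v_neq0. Qed.

Section Specialization.
Variable R : realType.

Lemma zeta_expE (t n : nat) :
  zeta R t ^+ n = (cos (n%:R * (2 * pi / t%:R)) +i* sin (n%:R * (2 * pi / t%:R)))%C.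
Proof.
elim: n => [|n IHn]; first by rewrite !mul0r cos0 sin0.
set a := 2 * pi / t%:R in IHn *.
rewrite exprS IHn -(add1n n) (natrD R 1 n) (mulrDl 1 _ a) mul1r cosD sinD.
by apply/eqP; rewrite eq_complex /= eqxx addrC eqxx.
Qed.

(** For a positive exponent [i.+1] below [t], the real part of the power is [1 - 2 sin^2 x] with
    [0 < x < pi], hence less than 1. *)
Lemma zeta_prim_root (t : nat) : (0 < t)%N -> t.-primitive_root (zeta R t).
Proof.
move=> t_gt0; have t_neq0 : t%:R != 0 :> R by rewrite pnatr_eq0 -lt0n.
apply/andP; split=> //; apply/forallP => i; rewrite unity_rootE zeta_expE.
apply/eqP; have [->|neq_it] := eqVneq i.+1 t.
  rewrite mulrCA divff // mulr1 mulrC mulr_natr cos2pi sin2pi.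
  by rewrite eq_complex /= !eqxx.
apply/negbTE; rewrite eq_complex /= negb_and; apply/orP; left.
set x := i.+1%:R * (pi / t%:R) : R.
have -> : i.+1%:R * (2 * pi / t%:R) = x *+ 2 by rewrite -mulr_natl /x; ring.
have sin_gt0 : 0 < sin x.
  apply: sin_gt0_pi; apply/andP; split.
    by rewrite mulr_gt0 ?ltr0n // divr_gt0 ?pi_gt0 ?ltr0n.
  rewrite /x mulrCA gtr_pMr ?pi_gt0 // ltr_pdivrMr ?ltr0n // mul1r ltr_nat.
  by rewrite ltn_neqAle neq_it /=.
have sin2_gt0 : 0 < sin x ^+ 2 by rewrite exprn_gt0.
rewrite cos_mulr2n cos2sin2 lt_eqF // -subr_gt0.
have -> : 1 - ((1 - sin x ^+ 2) *+ 2 - 1) = sin x ^+ 2 *+ 2 by ring.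
by rewrite pmulrn_lgt0.
Qed.

Local Notation h := (exp_half_theta R).

HB.instance Definition _ :=
  GRing.RMorphism.copy (@ratC R) (@FracField.tofrac {poly R[i]%C} \o polyC).

(** Vanishing would give ['X^(2n) = 1] among polynomials, against the degrees. *)
Lemma two_sinh_exp_half_neq0 (n : nat) : (0 < n)%N -> two_sinh h n != 0.
Proof.
move=> n_gt0; have h_neq0 : h != 0 by rewrite tofrac_eq0 polyX_eq0.
rewrite /two_sinh subr_eq0 -exprnN -exprnP; apply/negP => /eqP eq_h.
have : h ^+ n * h ^+ n = 1 by rewrite {1}eq_h mulVf ?expf_neq0.
rewrite -exprD -rmorphXn -(rmorph1 (@FracField.tofrac _)) => /eqP.
rewrite tofrac_eq => /eqP /(congr1 (fun p : {poly _} => size p)).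
by rewrite size_polyXn size_poly1 => -[]; lia.
Qed.

Lemma sinh_halfE (d : int) : sinh_half R d = two_sinh h d / 2.
Proof. by []. Qed.

Lemma prod_SSYT_weight (K : comNzRingType) (N n : nat) (lam : N.-tuple nat)
    (x : nat -> K) (T : filling lam n) :
  \prod_c x (T c) = \prod_(k < n) x k ^+ mult T k.+1.
Proof.
rewrite (partition_big T predT) //; apply: eq_bigr => k _.
rewrite (eq_bigr (fun=> x k)) => [|c /eqP->] //.
by rewrite prodr_const; congr (_ ^+ _); apply: eq_card => c; rewrite inE eqSS.
Qed.

Lemma spec_weight (t : nat) (lam : t.+2.-tuple nat) (T : filling lam t.+2) :
  ratC (zeta R t ^+ (\sum_(1 <= k < t.+1) (k - 1) * mult T k)%N) *
    exp_theta R ^ ((mult T t.+1)%:Z - (mult T t.+2)%:Z) =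
  \prod_c spec_point t h (ratC (zeta R t)) (T c).
Proof.
rewrite prod_SSYT_weight !big_ord_recr /= /spec_point !ltnn ltnNge leqnSn eqxx gtn_eqF //=.
have z_neq0 : exp_theta R != 0 by rewrite expf_neq0 // tofrac_eq0 polyX_eq0.
rewrite -mulrA; congr (_ * _).
  rewrite big_add1 big_mkord rmorphXn -prodrXr; apply: eq_bigr => k _ /=.
  by rewrite ltn_ord subn1 exprM.
by rewrite expfzDr // -exprnN -exprnP exprVn.
Qed.

End Specialization.

Unset Implicit Arguments.

Theorem corollary6p1 (R : realType) (t : nat) (lam : t.+2.-tuple nat)
    (ht : (2 <= t)%N) (hlam : is_partition lam) :
  let z := exp_theta R in
  \sum_(T in SSYT lam t.+2)
    ratC (zeta R t ^+ (\sum_(1 <= k < t.+1) (k - 1) * mult T k)%N) *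
    z ^ ((mult T t.+1)%:Z - (mult T t.+2)%:Z)
  = if has_empty_class lam t then 0 else
    if select_AB lam t is Some s then
      if d3t lam s == 0 then 0 else
      (eps lam t s)%:~R *
      (sinh_half R (d1 lam s) * sinh_half R (d2 lam s) * sinh_half R (d3 lam s)
       / (sinh_half R t%:Z ^+ 2 * sinh_half R 2))
    else 0.
Proof.
move=> z; rewrite /z {z}; under eq_bigr do rewrite spec_weight.
have t_gt0 := ltnW ht.
have h_neq0 : exp_half_theta R != 0 by rewrite tofrac_eq0 polyX_eq0.
have prim_w : t.-primitive_root (ratC (zeta R t)).
  by rewrite fmorph_primitive_root zeta_prim_root.
have sht := two_sinh_exp_half_neq0 R t_gt0.
have sh2 := two_sinh_exp_half_neq0 R (isT : 0 < 2)%N.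
have two_neq0 : 2 != 0 :> ratfun R.
  by rewrite -(rmorph_nat (@ratC R)) fmorph_eq0 pnatr_eq0.
have [empty|nonempty] := ifPn; first exact: (sum_SSYT_empty_class h_neq0 ht prim_w sht sh2 hlam).
have [s [-> hs]] := select_AB_spec t_gt0 nonempty.
rewrite (sum_SSYT_AB h_neq0 ht prim_w sht sh2 hlam hs).
(* When [d3t] is 0, so is the last factor of [eps], and the general formula already gives 0. *)
have [d3t0|_] := eqVneq; first by rewrite /eps d3t0 sgz0 mulr0 mul0r.
rewrite !sinh_halfE; congr (_ * _).
by rewrite (halved_ratio _ _ _ two_neq0 sht sh2).
Qed.
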